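(* Let $R$ be a ring with identity, $J(R)$ its Jacobson radical, $a,b,c\in R$ and $j_a\in J(R)$. Suppose $a^{\|(b,c)}$ exists (so that $b$ and $c$ are regular and $(a+j_a)^{\|(b,c)}$ exists), and let $b^+$ and $c^+$ be reflexive inverses of $b$ and $c$, respectively. Then the following statements are equivalent: (1) $(a+j_a)^{\|(b,c)}$ is idempotent; (2) $(a^{\|(b,c)})^2=a^{\|(b,c)}(a+j_a)a^{\|(b,c)}$; (3) $a+j_a=c^+cbb^++(1-c^+c)(a+j_a)+c^+c(a+j_a)(1-bb^+)$.
   Context: Rings are associative with identity, not necessarily commutative. For $a,b,c\in R$, an element $y\in R$ is the $(b,c)$-inverse of $a$ if $cay=c$, $yab=b$ and $y\in bR\cap Rc$; such $y$ is unique if it exists and is denoted $a^{\|(b,c)}$. It is known that if $a^{\|(b,c)}$ exists then $b$ and $c$ are regular, and that for $j_a\in J(R)$, $a^{\|(b,c)}$ exists if and only if $(a+j_a)^{\|(b,c)}$ exists. A reflexive inverse of $r\in R$ is an element $x$ with $rxr=r$ and $xrx=x$; $r$ is regular if $rxr=r$ for some $x$. *)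

(* Defs.v *)
From mathcomp Require Import all_boot all_algebra.
From mathcomp Require Import boolp classical_sets.

Set Implicit Arguments.
Unset Strict Implicit.
Unset Printing Implicit Defensive.

Import GRing.Theory.
Local Open Scope classical_set_scope.
Local Open Scope ring_scope.

(* [pzRingType] rather than [nzRingType]: the zero ring is not excluded. *)

Definition left_ideal (R : pzRingType) (I : set R) : Prop :=
  [/\ I 0, forall x y, I x -> I y -> I (x - y) & forall r x, I x -> I (r * x)].

Definition maximal_left_ideal (R : pzRingType) (M : set R) : Prop :=
  [/\ left_ideal M, M != setT &
      forall I : set R, left_ideal I -> M `<=` I -> I = M \/ I = setT].

Definition jacobson_radical (R : pzRingType) : set R :=
  [set x | forall M : set R, maximal_left_ideal M -> M x].
Arguments jacobson_radical R _ : clear implicits.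

Definition reflexive_inverse (R : pzRingType) (r x : R) : Prop :=
  r * x * r = r /\ x * r * x = x.

Definition is_idempotent (R : pzRingType) (x : R) : Prop := x * x = x.

Definition is_bc_inverse (R : pzRingType) (a b c y : R) : Prop :=
  [/\ c * a * y = c, y * a * b = b, exists s, y = b * s & exists t, y = t * c].

Definition bc_invertible (R : pzRingType) (a b c : R) : Prop :=
  exists y, is_bc_inverse a b c y.

(* The value is 0 when [a] has no (b,c)-inverse. *)
Definition bc_inverse (R : pzRingType) (a b c : R) : R :=
  xget 0 [set y | is_bc_inverse a b c y].

Lemma is_bc_inverse_unique (R : pzRingType) (a b c y z : R) :
  is_bc_inverse a b c y -> is_bc_inverse a b c z -> y = z.
Proof.
move=> [cay _ [s ys] _] [_ zab _ [t zt]].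
have zay : z * a * y = y by rewrite ys mulrA zab.
by rewrite -zay zt -!mulrA [c * _]mulrA cay.
Qed.

Lemma bc_inverseP (R : pzRingType) (a b c : R) :
  bc_invertible a b c -> is_bc_inverse a b c (bc_inverse a b c).
Proof. by case=> y ybc; exact: (xgetPex 0 (ex_intro _ y ybc)). Qed.

Lemma bc_inverseE (R : pzRingType) (a b c y : R) :
  is_bc_inverse a b c y -> bc_inverse a b c = y.
Proof.
move=> hy; have h : bc_invertible a b c by exists y.
exact: is_bc_inverse_unique (bc_inverseP h) hy.
Qed.

(* Main.v *)
Require Import Defs.
From mathcomp Require Import all_boot all_algebra.
From mathcomp Require Import boolp classical_sets.

Set Implicit Arguments.

Import GRing.Theory.
Local Open Scope ring_scope.

(**
Every proper left ideal lies in a maximal one (Zorn), so [1 + x] has a left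
inverse, hence is a unit, for every [x] in the radical. If [y] is the
(b,c)-inverse of [a] and [j] is in the radical, then [u := (1 + y j)^-1] exists
and [u y] is the (b,c)-inverse of [A := a + j].

Let [z] be the (b,c)-inverse of [A]. Since [y] and [z] both lie in [bR] and in
[Rc], one has [y A z = y = z A y], [z a y = z = y a z] and [z A z = z].
Multiplying by these factors translates [z z = z] into [y y = y A y] and back.
The third condition says [c A b = c b] (Peirce decomposition of [A] for the
idempotents [cp c] and [b bp]), which is equivalent to [z z = z] in the same
way.
*)

Lemma proper_left_ideal_sub_maximal (R : pzRingType) (I : set R) :
  left_ideal I -> ~ I 1 ->
  exists2 M, maximal_left_ideal M & (I `<=` M)%classic.
Proof.
move=> idI I1.
(* The empty set is admitted in [P] because [Zorn_bigcup] also asks for the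
   union of the empty chain. *)
pose P : set (set R) :=
  [set A | A = set0 \/ [/\ left_ideal A, ~ A 1 & (I `<=` A)%classic]]%classic.
have [F sFP totF|M [PM maxM]] := @Zorn_bigcup R P.
  have idF B x : F B -> B x -> [/\ left_ideal B, ~ B 1 & (I `<=` B)%classic].
    by move=> FB Bx; case: (sFP _ FB) => // B0; rewrite B0 in Bx.
  have [[A [FA [a Aa]]]|noA] := pselect (exists A, F A /\ exists a, A a);
    last first.
    left; rewrite -subset0 => x [A FA Ax].
    by apply: noA; exists A; split => //; exists x.
  have [[A0 _ _] A1 IA] := idF _ _ FA Aa.
  right; split; first split.
  - by exists A.
  - move=> x y [B FB Bx] [C FC Cy].
    have [[_ subB _] _ _] := idF _ _ FB Bx.
    have [[_ subC _] _ _] := idF _ _ FC Cy.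
    case: (totF _ _ FB FC) => [BC|CB].
    + by exists C => //; apply: subC => //; exact: BC.
    + by exists B => //; apply: subB => //; exact: CB.
  - move=> r x [B FB Bx]; exists B => //.
    by have [[_ _ mulB] _ _] := idF _ _ FB Bx; exact: mulB.
  - by move=> [B FB B1]; have [_ nB1 _] := idF _ _ FB B1.
  - by move=> x Ix; exists A => //; exact: IA.
have I0 : I 0 by case: idI.
have [idM M1 IM] : [/\ left_ideal M, ~ M 1 & (I `<=` M)%classic].
  (* The maximal element is not the empty set, since [I] lies in [P] and strictly contains it. *)
  case: PM => // M0; exfalso; apply: (maxM I); last by right; split.
  by rewrite M0; split=> [? //|/(_ _ I0)].
exists M => //; split=> // [|K idK MK].
  by apply/eqP => MT; apply: M1; rewrite MT.
have [K1|nK1] := pselect (K 1).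
  right; rewrite eqEsubset; split=> // x _.
  by case: idK => _ _ mulK; rewrite -[x]mulr1; exact: mulK.
left; apply: contrapT => KM; apply: (maxM K).
  by split=> // KM'; apply: KM; rewrite eqEsubset.
by right; split=> //; move=> x /IM /MK.
Qed.

Lemma jacobson_radical_mull (R : pzRingType) (r x : R) :
  jacobson_radical R x -> jacobson_radical R (r * x).
Proof.
by move=> Jx M maxM; case: (maxM) => -[_ _ mulM] _ _; exact/mulM/(Jx _ maxM).
Qed.

Lemma jacobson_radical_left_inverse (R : pzRingType) (x : R) :
  jacobson_radical R x -> exists u, u * (1 + x) = 1.
Proof.
move=> Jx; apply: contrapT => nou.
(* Were [I] proper, a maximal [M] above it would contain [1 + x] and [x], hence [1]. *)
pose I : set R := [set r | exists u, u * (1 + x) = r]%classic.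
have idI : left_ideal I.
  split; first by exists 0; rewrite mul0r.
  - by move=> _ _ [u <-] [v <-]; exists (u - v); rewrite mulrBl.
  - by move=> r _ [u <-]; exists (r * u); rewrite mulrA.
have [//|M maxM IM] := proper_left_ideal_sub_maximal idI.
have [[M0 subM mulM] /eqP MT _] := maxM; apply: MT.
have M1 : M 1.
  rewrite -[1](addrK x); apply: subM; last exact: Jx.
  by apply: IM; exists 1; rewrite mul1r.
by rewrite eqEsubset; split=> // r _; rewrite -[r]mulr1; exact: mulM.
Qed.

(** The left inverse [u] equals [1 + - u * x], so it has a left inverse [v] of its own, and
    [v = 1 + x]. *)
Lemma jacobson_radical_inverse (R : pzRingType) (x : R) :
  jacobson_radical R x -> exists u, u * (1 + x) = 1 /\ (1 + x) * u = 1.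
Proof.
move=> Jx; have [u ux] := jacobson_radical_left_inverse Jx.
have uE : 1 + - u * x = u by rewrite -ux mulrDr mulr1 mulNr addrK.
have [v vu] := jacobson_radical_left_inverse (jacobson_radical_mull (- u) Jx).
rewrite uE in vu; exists u; split=> //.
by have := congr1 ( *%R v) ux; rewrite mulrA vu mul1r mulr1 => ->.
Qed.

Lemma bc_invertible_addr_jacobson (R : pzRingType) (a b c j : R) :
  jacobson_radical R j -> bc_invertible a b c -> bc_invertible (a + j) b c.
Proof.
move=> Jj [y [cay yab [s ys] [t yt]]].
have [u [uw wu]] := jacobson_radical_inverse (jacobson_radical_mull y Jj).
exists (u * y); split.
- have -> : c * (a + j) = c * a * (1 + y * j).
    by rewrite !mulrDr mulr1 mulrA cay.
  by rewrite -mulrA [_ * (u * y)]mulrA wu mul1r.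
- have yAb : y * (a + j) * b = (1 + y * j) * b.
    by rewrite mulrDr !mulrDl mul1r yab.
  by rewrite -!mulrA [y * _]mulrA yAb mulrA uw mul1r.
(* As [u = 1 - y * j * u], a factor [b] comes out of [u * y] on the left through [y = b * s]. *)
- exists (s - s * j * u * y).
  have {1}-> : u = 1 - y * j * u by rewrite -wu mulrDl mul1r addrK.
  by rewrite mulrBl mul1r mulrBr !mulrA -ys.
- by exists (u * t); rewrite -mulrA -yt.
Qed.

(** [y * a] is a left identity on [bR] and [a * y] a right identity on [Rc]; [z] lies in both. *)
Lemma is_bc_inverse_mulr (R : pzRingType) (a a' b c y z : R) :
  is_bc_inverse a b c y -> is_bc_inverse a' b c z ->
  y * a * z = z /\ z * a * y = z.
Proof.
move=> [cay yab _ _] [_ _ [s zs] [t zt]]; split.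
  by rewrite {1}zs mulrA yab -zs.
by rewrite {1}zt -!mulrA [c * _]mulrA cay -zt.
Qed.

(** Forward, [c * b = (c * a * z) * (z * a * b)]; backward, [z * z = t * (c * b) * s] turns into
    [z * a * z]. *)
Lemma is_bc_inverse_idempotent (R : pzRingType) (a b c z : R) :
  is_bc_inverse a b c z -> z * z = z <-> c * a * b = c * b.
Proof.
move=> hz; have [_ zaz] := is_bc_inverse_mulr hz hz.
have [caz zab [s zs] [t zt]] := hz; split=> [zz|cab].
  rewrite -[in RHS]caz -[X in _ = _ * X]zab.
  by rewrite !mulrA -[c * a * z * z]mulrA zz caz.
rewrite {1}zt [X in _ * X]zs mulrA -[t * c * b]mulrA -cab.
by rewrite !mulrA -zt -mulrA -zs.
Qed.

(** With [p := cp * c] and [q := b * bp], the last two summands add up to [x - p * x * q], so the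
    equation only constrains the corner [p * x * q]. *)
Lemma peirce_corner (R : pzRingType) (x b c bp cp : R) :
  reflexive_inverse b bp -> reflexive_inverse c cp ->
  x = cp * c * b * bp + (1 - cp * c) * x + cp * c * x * (1 - b * bp)
  <-> c * x * b = c * b.
Proof.
move=> [bbpb _] [ccpc _].
have -> : x = cp * c * b * bp + (1 - cp * c) * x + cp * c * x * (1 - b * bp)
    <-> cp * c * x * (b * bp) = cp * c * b * bp.
  rewrite mulrBl mul1r mulrBr mulr1.
  set e := cp * c * x; set f := cp * c * b * bp; set g := e * (b * bp).
  have -> : f + (x - e) + (e - g) = x + (f - g).
    by rewrite addrA -[f + _ + e]addrA subrK [f + x]addrC -addrA.
  split=> [/eqP|->]; last by rewrite subrr addr0.
  by rewrite -{1}[x]addr0 (inj_eq (addrI x)) eq_sym subr_eq0 => /eqP.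
split=> h; last first.
  by rewrite !mulrA -[cp * c * x]mulrA -[cp * _ * b]mulrA h mulrA.
have bE w : w * b * bp * b = w * b by rewrite -2!mulrA [b * _]mulrA bbpb.
by have := congr1 (fun w => c * w * b) h; rewrite !mulrA ccpc !bE.
Qed.

Unset Implicit Arguments.

Theorem corollary3p9 (R : pzRingType) (a b c ja bp cp : R)
    (hja : jacobson_radical R ja)
    (ha : bc_invertible a b c)
    (hbp : reflexive_inverse b bp)
    (hcp : reflexive_inverse c cp) :
  bc_invertible (a + ja) b c /\
  [<-> is_idempotent (bc_inverse (a + ja) b c);
       bc_inverse a b c ^+ 2 = bc_inverse a b c * (a + ja) * bc_inverse a b c;
       a + ja = cp * c * b * bp + (1 - cp * c) * (a + ja)
                + cp * c * (a + ja) * (1 - b * bp)].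
Proof.
have hA := bc_invertible_addr_jacobson hja ha; split=> //.
have hy := bc_inverseP ha; have hz := bc_inverseP hA.
move: (bc_inverse a b c) (bc_inverse (a + ja) b c) hy hz => y z hy hz.
have [yaz zay] := is_bc_inverse_mulr hy hz.
have [zAy yAz] := is_bc_inverse_mulr hz hy.
have [zAz _] := is_bc_inverse_mulr hz hz.
rewrite /is_idempotent expr2; tfae=> [zz|yy|].
- by rewrite -{1}yAz -[X in _ * X]zAy !mulrA -[_ * z * z]mulrA zz yAz.
- apply/(peirce_corner _ hbp hcp).
  apply/(is_bc_inverse_idempotent hz).
  (* [z * z = z * a * (y * y) * a * z], and with [yy] this collapses to [z * (a + ja) * z]. *)
  rewrite -{1}zay -[X in _ * X]yaz !mulrA -[z * a * y * y]mulrA yy !mulrA zay.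
  by rewrite -2!mulrA [y * _]mulrA yaz.
- by move/(peirce_corner _ hbp hcp)/(is_bc_inverse_idempotent hz).
Qed.
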